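(* Let $\Sigma$ and $\Gamma$ be finite alphabets and let $w,w'\in(\Sigma\cap\Gamma)^*$. Then $w$ and $w'$ are strongly $M$-equivalent with respect to $\Sigma$ if and only if they are strongly $M$-equivalent with respect to $\Gamma$.
   Context: Parikh matrices: for an ordered alphabet $\Delta=\{a_1<a_2<\dots<a_s\}$, the Parikh matrix mapping $\Psi_\Delta:\Delta^*\to\mathcal M_{s+1}$ is the monoid morphism into the multiplicative monoid of $(s+1)\times(s+1)$ upper triangular matrices with nonnegative integer entries and unit diagonal that sends $a_q$ to the matrix with $1$'s on the diagonal, $1$ in position $(q,q+1)$, and $0$ elsewhere. Two words are $M$-equivalent with respect to $\Delta$ iff they have the same image under $\Psi_\Delta$. Strong $M$-equivalence: for an (unordered) alphabet $\Sigma$, words $w,w'\in\Sigma^*$ are strongly $M$-equivalent with respect to $\Sigma$ iff they are $M$-equivalent with respect to every ordered alphabet whose underlying set is $\Sigma$. *)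

(* Defs.v *)
From mathcomp Require Import all_boot all_order all_algebra.
From mathcomp Require Import finmap.

Set Implicit Arguments.
Unset Strict Implicit.
Unset Printing Implicit Defensive.

Import GRing.Theory.
Local Open Scope ring_scope.

(* Letters are drawn from an ambient choiceType K and alphabets are finite    *)
(* sets over K, so that one word can be a word over several alphabets.        *)

Definition word_over (K : choiceType) (A : {fset K}) (w : seq K) : Prop :=
  {subset w <= A}.

(* An ordered alphabet a_1 < ... < a_s is the duplicate-free sequence         *)
(* [:: a_1; ...; a_s] of its letters in increasing order.                     *)
Definition ordering_of (K : choiceType) (A : {fset K}) (D : seq K) : Prop :=
  uniq D /\ D =i A.

(* Indices start at 0: the letter a_q has index q - 1 in D, so position       *)
(* (q, q+1) becomes (index a D, (index a D).+1).                              *)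
(* A letter outside D, which is not in the domain of the Parikh matrix        *)
(* mapping, gets the junk value 1.                                            *)
Definition letter_mx (K : choiceType) (D : seq K) (a : K) :
    'M[nat]_((size D).+1) :=
  \matrix_(i, j) nat_of_bool
    ((i == j) || ((i == index a D :> nat) && (j == (index a D).+1 :> nat))).

Definition parikh_mx (K : choiceType) (D : seq K) (w : seq K) :
    'M[nat]_((size D).+1) :=
  \prod_(a <- w) letter_mx D a.

Definition M_equiv (K : choiceType) (D : seq K) (w w' : seq K) : Prop :=
  parikh_mx D w = parikh_mx D w'.

Definition strong_M_equiv (K : choiceType) (A : {fset K}) (w w' : seq K) :
    Prop :=
  forall D : seq K, ordering_of A D -> M_equiv D w w'.

(* Main.v *)
Require Import Defs.
From mathcomp Require Import all_boot all_order all_algebra.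
From mathcomp Require Import finmap.

(** The entries of the Parikh matrix of [w] over [a_1 < ... < a_s] count the
    occurrences in [w] of the factors [a_i ... a_j] as scattered subwords. Any
    word with distinct letters over an alphabet is a factor of some ordering of
    it, so strong M-equivalence says that all such words occur equally often in
    [w] and [w']. A word using a letter outside the common alphabet occurs in
    neither, so the ambient alphabet is irrelevant. *)

(** The binomial coefficient of words: embeddings of [v] are split by whether they use the first
    letter of [w]. *)
Fixpoint subword_count {K : eqType} (v w : seq K) : nat :=
  match v, w with
  | [::], _ => 1
  | _ :: _, [::] => 0
  | b :: v', a :: w' => subword_count v w' + (a == b) * subword_count v' w'
  end.

Lemma subword_count_nil (K : eqType) (w : seq K) : subword_count [::] w = 1.
Proof. by case: w. Qed.

Lemma subword_count_eq0 (K : eqType) (x : K) (v w : seq K) :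
  x \in v -> x \notin w -> subword_count v w = 0.
Proof.
elim: w v => [|a w IHw] [|b v] //= xv.
rewrite inE negb_or => /andP[xa xw]; rewrite IHw //.
have [ab|_] //= := eqVneq a b.
by move: xv; rewrite inE -ab (negPf xa) /= => xv; rewrite IHw.
Qed.

(** Row [i] of [letter_mx D a] has at most one off-diagonal entry. A letter outside [D] has index
    [size D], which the bound on [i] excludes: its matrix is the identity. *)
Lemma letter_mxM (K : choiceType) (D : seq K) (a : K)
    (P : 'M[nat]_((size D).+1)) (i j : 'I_(size D).+1) :
  (letter_mx D a * P)%R i j =
  P i j + (if (i < size D) && (i == index a D :> nat)
           then P (inord i.+1) j else 0).
Proof.
rewrite mxE (bigD1 i) //= mxE eqxx /= GRing.mul1r; congr (_ + _).
case: ifP => [/andP[ltiD /eqP ia]|Nia].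
  have i1E : (inord i.+1 : 'I_(size D).+1) = i.+1 :> nat by rewrite inordK.
  rewrite (bigD1 (inord i.+1)) /=; last first.
    by rewrite -val_eqE /= i1E gtn_eqF.
  rewrite mxE i1E -ia !eqxx orbT GRing.mul1r big1 ?GRing.addr0 // => k.
  move=> /andP[ki ki1]; rewrite mxE -ia eq_sym (negPf ki) eqxx /= -i1E.
  by rewrite (_ : (k == _ :> nat) = false) ?GRing.mul0r //; apply: negPf.
rewrite big1 // => k ki; rewrite mxE eq_sym (negPf ki) /=.
case: eqP => [ia|_]; last by rewrite GRing.mul0r.
case: eqP => [ka|_]; last by rewrite GRing.mul0r.
move: Nia (ltn_ord k); rewrite ka -ia eqxx andbT ltnS => ->; by [].
Qed.

(** Prepending [a] to [w] adds row [i.+1] to row [i] exactly when [a] is the letter of [D] at [i],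
    hence the first letter of the factor; this is the recursion of [subword_count]. *)
Lemma parikh_mxE (K : choiceType) (D w : seq K) (i j : 'I_(size D).+1) :
  uniq D ->
  parikh_mx D w i j =
  if i <= j then subword_count (take (j - i) (drop i D)) w else 0.
Proof.
move=> uD; rewrite /parikh_mx; elim: w i => [|a w IHw] i.
  rewrite big_nil mxE -val_eqE /=; case: ltngtP => // [ij|->]; last first.
    by rewrite subnn take0.
  have iD : i < size D by rewrite (leq_trans ij) // -ltnS.
  (* The letter [x] only serves as the default value in [drop_nth]. *)
  have /hasP[x _ _] : has predT D by rewrite has_predT (leq_trans _ iD).
  by rewrite (drop_nth x iD) -(subnSK ij).
rewrite big_cons letter_mxM !IHw; case: (ltnP i (size D)) => iD /=; last first.
  by rewrite addn0 drop_oversize //= !subword_count_nil.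
rewrite inordK //; case: (ltngtP i j) => [ij|ij|ij].
- rewrite (drop_nth a iD) -(subnSK ij) /=; congr (_ + _).
  rewrite (_ : (a == nth a D i) = (i == index a D :> nat)).
    by case: eqP => _; rewrite ?mul1n ?mul0n.
  apply/eqP/eqP => [->|ia]; first by rewrite index_uniq.
  by rewrite ia nth_index // -index_mem -ia.
- by case: ifP.
- by rewrite ij subnn !take0 !subword_count_nil /= if_same.
Qed.

Lemma strong_M_equivP (K : choiceType) (A : {fset K}) (w w' : seq K) :
  strong_M_equiv A w w' <->
  forall v : seq K, uniq v -> {subset v <= A} ->
    subword_count v w = subword_count v w'.
Proof.
split=> [Aww' v uv vA|cnt_eq D [uD DA]]; last first.
  apply/matrixP => i j; rewrite !parikh_mxE //; case: ifP => // _.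
  apply: cnt_eq => [|x /mem_take/mem_drop]; last by rewrite DA.
  by rewrite take_uniq // drop_uniq.
(* An ordering of [A] with prefix [v], so that entry [(0, size v)] of the Parikh matrix counts
   [v]. *)
pose D := v ++ [seq x <- A | x \notin v].
have uD : uniq D.
  rewrite cat_uniq uv filter_uniq ?fset_uniq // andbT /=.
  by apply/hasPn => x; rewrite mem_filter => /andP[].
have DA : D =i A.
  move=> x; rewrite mem_cat mem_filter; case: (boolP (x \in v)) => //= xv.
  by rewrite vA.
have vD : size v < (size D).+1 by rewrite ltnS size_cat leq_addr.
have /matrixP/(_ ord0 (Ordinal vD)) := Aww' D (conj uD DA).
by rewrite !parikh_mxE //= subn0 drop0 take_size_cat.
Qed.

Lemma strong_M_equiv_alphabet (K : choiceType) (A B : {fset K})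
    (w w' : seq K) :
  word_over A w -> word_over A w' ->
  strong_M_equiv A w w' -> strong_M_equiv B w w'.
Proof.
move=> wA w'A /strong_M_equivP Aww'; apply/strong_M_equivP => v uv _.
(* If [v] has a letter [x] outside [A], then [x] is in neither word and both counts vanish. *)
have [/allP vA|/allPn[x xv xA]] := boolP (all [in A] v); first exact: Aww'.
by rewrite !(subword_count_eq0 _ _ _ _ xv) //; apply: contra xA => xw;
  (exact: wA || exact: w'A).
Qed.

Local Open Scope fset_scope.

Theorem proposition3p4 (K : choiceType) (Sigma Gamma : {fset K})
    (w w' : seq K)
    (hw : word_over (Sigma `&` Gamma) w)
    (hw' : word_over (Sigma `&` Gamma) w') :
  strong_M_equiv Sigma w w' <-> strong_M_equiv Gamma w w'.
Proof.
by split; apply: strong_M_equiv_alphabet => x => [/hw|/hw'];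
  rewrite in_fsetI => /andP[].
Qed.
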